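(* Let $\Omega$ be a locally compact Hausdorff topological space. Put $I=C_c(\Omega)$. The following convergences on $C_0(\Omega)$ coincide: $\mathrm{u}(\mathrm{ru})$, $\mathrm{u}_I(\mathrm{ru})$, $\mathrm{un}$, $\mathrm{u}_I\mathrm{n}$, and $\mathrm{ucc}$. In particular, $\mathrm{ucc}$ is unbounded on $C_0(\Omega)$.
   Context: $C_0(\Omega)$ is the Banach lattice of continuous real-valued functions on $\Omega$ vanishing at infinity, with the supremum norm; $C_c(\Omega)$ is the ideal of $C_0(\Omega)$ consisting of the continuous functions with compact support. Convergences are given by specifying which nets converge to which points; they coincide if the same nets converge to the same limits. On a vector lattice $X$: $\mathrm{ru}$ (relative uniform convergence): $x_\alpha\to x$ if there is $e\in X_+$ such that for every $\varepsilon>0$ there is $\alpha_0$ with $|x_\alpha-x|\le\varepsilon e$ for all $\alpha\ge\alpha_0$. $\mathrm{n}$ is norm convergence. For a convergence $\eta$ on $X$ and an ideal $I$ of $X$, $\mathrm{u}_I\eta$ is defined by: $x_\alpha\to x$ in $\mathrm{u}_I\eta$ iff $|x_\alpha-x|\wedge u\to 0$ in $\eta$ for every $u\in I_+$; $\mathrm{u}\eta=\mathrm{u}_X\eta$, and $\mathrm{un}$ denotes $\mathrm{u}\eta$ for $\eta=\mathrm{n}$. Here $X=C_0(\Omega)$. $\mathrm{ucc}$: $f_\alpha\to f$ if $f_\alpha\to f$ uniformly on every compact subset of $\Omega$. A convergence $\eta$ is unbounded if $\mathrm{u}\eta=\eta$. *)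

(* Defs.v *)
From HB Require Import structures.
From mathcomp Require Import all_boot all_order all_algebra.
From mathcomp Require Import all_classical all_reals all_analysis.

Set Implicit Arguments.
Unset Strict Implicit.
Unset Printing Implicit Defensive.

Import Order.TTheory GRing.Theory Num.Theory.
Import numFieldNormedType.Exports.

Local Open Scope classical_set_scope.
Local Open Scope ring_scope.

(* Not an HB structure: a join of Lmodule with Order.Lattice would have to be
   declared below Num.RealDomain, hence the explicit order-theoretic fields. *)
Record vectorLatticeType (R : realType) := VectorLattice {
  vl_sort :> lmodType R ;
  vle : vl_sort -> vl_sort -> Prop ;
  vjoin : vl_sort -> vl_sort -> vl_sort ;
  vmeet : vl_sort -> vl_sort -> vl_sort ;
  vle_refl : forall x, vle x x ;
  vle_anti : forall x y, vle x y -> vle y x -> x = y ;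
  vle_trans : forall x y z, vle x y -> vle y z -> vle x z ;
  vleUl : forall x y, vle x (vjoin x y) ;
  vleUr : forall x y, vle y (vjoin x y) ;
  vleUx : forall x y z, vle x z -> vle y z -> vle (vjoin x y) z ;
  vleIl : forall x y, vle (vmeet x y) x ;
  vleIr : forall x y, vle (vmeet x y) y ;
  vlexI : forall x y z, vle z x -> vle z y -> vle z (vmeet x y) ;
  vle_add2r : forall z x y, vle x y -> vle (x + z) (y + z) ;
  vle_scale2l : forall (a : R) x y, 0 <= a -> vle x y -> vle (a *: x) (a *: y)
}.

Section VectorLattices.
Variables (R : realType) (X : vectorLatticeType R).

Definition vabs (x : X) : X := vjoin x (- x).

Definition vpos : set X := [set x | vle 0 x].

Record vlideal := VLIdeal {
  vlideal_set :> set X ;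
  vlideal0 : vlideal_set 0 ;
  vlidealD : forall x y, vlideal_set x -> vlideal_set y -> vlideal_set (x + y) ;
  vlidealZ : forall (a : R) x, vlideal_set x -> vlideal_set (a *: x) ;
  vlideal_solid : forall x y,
    vlideal_set y -> vle (vabs x) (vabs y) -> vlideal_set x
}.

Definition vlidealT : vlideal :=
  @VLIdeal setT I (fun _ _ _ _ => I) (fun _ _ _ => I) (fun _ _ _ _ => I).

End VectorLattices.

Record directedType := DirectedType {
  dir_sort :> Type ;
  dir_le : dir_sort -> dir_sort -> Prop ;
  dir_refl : forall a, dir_le a a ;
  dir_trans : forall a b c, dir_le a b -> dir_le b c -> dir_le a c ;
  dir_directed : forall a b, exists c, dir_le a c /\ dir_le b c ;
  dir_inhabited : inhabited dir_sort
}.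

(* The filter of tails of a directed set, so that [\forall a \near tails A, P a]
   reads "there is a0 such that P a for all a >= a0" and [x @ tails A --> l] is
   the convergence of the net x to l. *)
Definition tails (A : directedType) : set_system A :=
  [set S | exists a0 : A, forall a, dir_le a0 a -> S a].
Arguments tails : clear implicits.

Global Instance tails_filter (A : directedType) : ProperFilter (tails A).
Proof.
split.
  by case=> a0 /(_ a0) [] //; exact: dir_refl.
split.
- by case: (dir_inhabited A) => a; exists a.
- move=> P Q [a aP] [b bQ]; have [c [ac bc]] := dir_directed a b.
  by exists c => d cd; split; [apply: aP|apply: bQ]; apply: dir_trans cd.
- by move=> P Q PQ [a aP]; exists a => b /aP; exact: PQ.
Qed.

Definition convergence (X : Type) :=
  forall A : directedType, (A -> X) -> X -> Prop.

Definition coincide (X : Type) (eta zeta : convergence X) :=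
  forall (A : directedType) (x_ : A -> X) (x : X),
    eta A x_ x <-> zeta A x_ x.

Section Convergences.
Variables (R : realType) (X : vectorLatticeType R).

Definition ru : convergence X :=
  fun A x_ x => exists2 e : X, vpos e &
    forall eps : R, 0 < eps ->
      \forall a \near tails A, vle (vabs (x_ a - x)) (eps *: e).

Definition uI (I : vlideal X) (eta : convergence X) : convergence X :=
  fun A x_ x => forall u : X, (I : set X) u -> vpos u ->
    eta A (fun a => vmeet (vabs (x_ a - x)) u) 0.

Definition uconv (eta : convergence X) : convergence X :=
  uI (vlidealT X) eta.

Definition unbounded (eta : convergence X) : Prop :=
  coincide (uconv eta) eta.

End Convergences.

Definition nconv (R : realType) (X : normedModType R) : convergence X :=
  fun A x_ x => x_ @ tails A --> x.

Arguments ru {R} X.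
Arguments nconv {R} X.

Section C0.
Variables (R : realType) (T : topologicalType).
Implicit Types f g : T -> R.

Definition vanishes_at_infinity f :=
  forall eps : R, 0 < eps -> compact [set t | eps <= `|f t|].

Definition C0_pred : {pred T -> R} :=
  [pred f : T -> R | `[< continuous f /\ vanishes_at_infinity f >]].

Lemma C0_predP f :
  reflect (continuous f /\ vanishes_at_infinity f) (f \in C0_pred).
Proof. by rewrite inE; exact: asboolP. Qed.

Lemma closed_ge_norm f (eps : R) : continuous f -> closed [set t | eps <= `|f t|].
Proof.
move=> cf; rewrite [X in closed X](_ : _ = (fun t => `|f t|) @^-1` [set x | eps <= x]) //.
apply: closed_comp; last exact: closed_ge.
by move=> t _; apply: continuous_comp; [exact: cf|exact: norm_continuous].
Qed.

Lemma C0_dom f g h (k : R) : 0 < k -> continuous f ->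
  vanishes_at_infinity g -> vanishes_at_infinity h ->
  (forall t, `|f t| <= k * (`|g t| + `|h t|)) -> vanishes_at_infinity f.
Proof.
move=> k0 cf vg vh fgh eps eps0.
have e0 : 0 < eps / k / 2 by rewrite !divr_gt0.
apply: subclosed_compact (compactU (vg _ e0) (vh _ e0)) _.
  exact: closed_ge_norm.
move=> t /= et.
have [|gt] := leP (eps / k / 2) `|g t|; first by left.
have [|ht] := leP (eps / k / 2) `|h t|; first by right.
suff : `|f t| < eps by rewrite ltNge et.
apply: le_lt_trans (fgh t) _; rewrite mulrC -ltr_pdivlMr //.
by rewrite (splitr (eps / k)) ltrD.
Qed.

Lemma C0_submod : submod_closed C0_pred.
Proof.
split.
  apply/C0_predP; split; first by move=> t; exact: cst_continuous.
  move=> eps eps0; rewrite [X in compact X](_ : _ = set0); first exact: compact0.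
  by apply/seteqP; split=> t //=; rewrite normr0 leNgt eps0.
move=> a f g /C0_predP[cf vf] /C0_predP[cg vg]; apply/C0_predP.
have c : continuous (a *: f + g).
  move=> t; rewrite /continuous_at /=.
  by apply: (@cvgD _ R^o _ _ _ (fun t => a * f t) g _ _ _ (cg t)); exact: cvgMl_tmp (cf t).
split => //; apply: (@C0_dom _ f g (`|a| + 1)) => //.
move=> t; apply: le_trans (ler_normD _ _) _.
rewrite normrM mulrDr lerD //; first by rewrite ler_wpM2r// lerDl.
by rewrite ler_peMl // lerDr.
Qed.

HB.instance Definition _ := GRing.isSubmodClosed.Build R (T -> R) C0_pred C0_submod.

Record C0 := MkC0 { C0_fun :> T -> R ; C0_mem : C0_fun \in C0_pred }.

HB.instance Definition _ := [isSub for C0_fun].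
HB.instance Definition _ := [Choice of C0 by <:].
HB.instance Definition _ := [SubChoice_isSubLmodule of C0 by <:].


Implicit Types u v w : C0.

Lemma C0_continuous u : continuous u.
Proof. by have /C0_predP[] := C0_mem u. Qed.

Lemma C0_vanish u : vanishes_at_infinity u.
Proof. by have /C0_predP[] := C0_mem u. Qed.

Lemma C0_eq u v : u =1 v -> u = v.
Proof. by move=> uv; apply: val_inj; apply/funext. Qed.

Lemma C0_max_mem u v : (fun t => Num.max (u t) (v t)) \in C0_pred.
Proof.
have cm : continuous (fun t => Num.max (u t) (v t)).
  by move=> t; apply: continuous_max; exact: C0_continuous.
apply/C0_predP; split => //.
apply: (@C0_dom _ u v 1) => //; try exact: C0_vanish.
move=> t; rewrite mul1r; case: (leP (u t) (v t)) => _; rewrite ?lerDr ?lerDl normr_ge0 //.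
Qed.

Lemma C0_min_mem u v : (fun t => Num.min (u t) (v t)) \in C0_pred.
Proof.
have cm : continuous (fun t => Num.min (u t) (v t)).
  by move=> t; apply: continuous_min; exact: C0_continuous.
apply/C0_predP; split => //.
apply: (@C0_dom _ u v 1) => //; try exact: C0_vanish.
move=> t; rewrite mul1r; case: (leP (u t) (v t)) => _; rewrite ?lerDr ?lerDl normr_ge0 //.
Qed.

Definition C0_le u v := forall t, u t <= v t.
Definition C0_max u v : C0 := MkC0 (C0_max_mem u v).
Definition C0_min u v : C0 := MkC0 (C0_min_mem u v).

Definition C0_VL : vectorLatticeType R.
Proof.
refine (@VectorLattice R C0 C0_le C0_max C0_min _ _ _ _ _ _ _ _ _ _ _).
- by move=> u t.
- by move=> u v uv vu; apply: C0_eq => t; apply/eqP; rewrite eq_le uv vu.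
- by move=> u v w uv vw t; apply: le_trans (uv t) (vw t).
- by move=> u v t /=; rewrite le_max lexx.
- by move=> u v t /=; rewrite le_max lexx orbT.
- by move=> u v w uw vw t /=; rewrite ge_max uw vw.
- by move=> u v t /=; rewrite ge_min lexx.
- by move=> u v t /=; rewrite ge_min lexx orbT.
- by move=> u v w uw vw t /=; rewrite le_min uw vw.
- by move=> w u v uv t; rewrite lerD2r.
- by move=> a u v a0 uv t; rewrite ler_wpM2l.
Defined.

(* For empty T this is [sup set0 = 0]. *)
Definition C0_norm u : R := sup (range (fun t => `|u t|)).

Lemma C0_bounded u : has_ubound (range (fun t => `|u t|)).
Proof.
have cu : {within [set t | 1 <= `|u t|], continuous (fun t => `|u t|)}.
  apply: continuous_subspaceT => t; apply: continuous_comp.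
    exact: C0_continuous.
  exact: norm_continuous.
have /compact_bounded[M [_ HM]] := continuous_compact cu (@C0_vanish u _ ltr01).
exists (Num.max 1 (M + 1)) => _ [t _ <-]; rewrite le_max.
have [|ut] := leP `|u t| 1; first by [].
apply/orP; right; rewrite -[leLHS]normr_id; apply: (HM (M + 1)); first by rewrite ltrDl.
by exists t => //; exact: ltW.
Qed.

Lemma C0_norm_ge u t : `|u t| <= C0_norm u.
Proof. by apply: ub_le_sup; [exact: C0_bounded|exists t]. Qed.

Lemma C0_norm_le u (k : R) : 0 <= k -> (forall t, `|u t| <= k) -> C0_norm u <= k.
Proof.
move=> k0 uk; have [[x rx]|r0] := pselect (range (fun t => `|u t|) !=set0).
  by apply: ge_sup; [exists x|move=> _ [t _ <-]].
have r00 : range (fun t => `|u t|) = set0.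
  by apply/eqP; apply: contrapT => /negP/set0P.
by rewrite /C0_norm r00 sup0.
Qed.

Lemma C0_norm_ge0 u : 0 <= C0_norm u.
Proof.
have [[_ [t _ _]]|r0] := pselect (range (fun t => `|u t|) !=set0).
  exact: le_trans (C0_norm_ge u t).
have r00 : range (fun t => `|u t|) = set0.
  by apply/eqP; apply: contrapT => /negP/set0P.
by rewrite /C0_norm r00 sup0.
Qed.

Lemma C0_normD u v : C0_norm (u + v) <= C0_norm u + C0_norm v.
Proof.
apply: C0_norm_le => [|t]; first by rewrite addr_ge0 ?C0_norm_ge0.
by apply: le_trans (ler_normD _ _) _; rewrite lerD ?C0_norm_ge.
Qed.

Lemma C0_normZ (a : R) u : C0_norm (a *: u) = `|a| * C0_norm u.
Proof.
have le b w : C0_norm (b *: w) <= `|b| * C0_norm w.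
  apply: C0_norm_le => [|t]; first by rewrite mulr_ge0 ?C0_norm_ge0.
  by rewrite normrM ler_wpM2l ?C0_norm_ge.
apply/eqP; rewrite eq_le le /=.
have [->|a0] := eqVneq a 0; first by rewrite normr0 mul0r C0_norm_ge0.
rewrite -ler_pdivlMl ?normr_gt0 // -normfV.
by apply: le_trans (le _ _); rewrite scalerA mulVf // scale1r.
Qed.

Lemma C0_norm_eq0 u : C0_norm u = 0 -> u = 0.
Proof.
move=> u0; apply: C0_eq => t; apply/eqP; rewrite -normr_le0.
by rewrite -u0; exact: C0_norm_ge.
Qed.

HB.instance Definition _ :=
  @Lmodule_isNormed.Build R C0 C0_norm C0_normD C0_normZ C0_norm_eq0.

Definition Cc_set : set C0 := [set u | compact (closure [set t | u t != 0])].

Lemma Cc_sub u v w : (forall t, u t != 0 -> v t != 0 \/ w t != 0) ->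
  Cc_set v -> Cc_set w -> Cc_set u.
Proof.
move=> uvw cv cw; apply: subclosed_compact (compactU cv cw) _.
  exact: closed_closure.
by rewrite -closureU; apply: closureS => t; exact: uvw.
Qed.

Definition Cc : vlideal C0_VL.
Proof.
refine (@VLIdeal R C0_VL Cc_set _ _ _ _).
- rewrite /Cc_set /= (_ : [set t | _] = set0); first by rewrite closure0; exact: compact0.
  by apply/seteqP; split=> t //=; rewrite eqxx.
- move=> u v; apply: Cc_sub => t; apply: contra_neqP => /not_orP[].
  by move=> /negP/negPn/eqP u0 /negP/negPn/eqP v0; rewrite /= -[LHS]/(u t + v t) u0 v0 addr0.
- move=> a u cu; apply: (Cc_sub _ cu cu) => t au; left.
  by apply: contra_neq au => u0; rewrite -[LHS]/(a * u t) u0 mulr0.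
- move=> u v cv uv; apply: (Cc_sub _ cv cv) => t; move=> u0; left.
  apply: contra_neq u0 => v0.
  have : Num.max (u t) (- u t) <= Num.max (v t) (- v t) := uv t.
  rewrite v0 oppr0 maxxx.
  rewrite ge_max => /andP[u_le0]; rewrite oppr_le0 => u_ge0.
  by apply/eqP; rewrite eq_le u_le0.
Defined.

Definition ucc : convergence C0 := fun A x_ x =>
  forall K : set T, compact K ->
    {uniform K, (fun a => x_ a : T -> R) @ tails A --> (x : T -> R)}.

End C0.

Arguments ucc : clear implicits.

(* Main.v *)
Require Import Defs.
From HB Require Import structures.
From mathcomp Require Import all_boot all_order all_algebra.
From mathcomp Require Import all_classical all_reals all_analysis.

Local Open Scope classical_set_scope.

Import Order.TTheory GRing.Theory Num.Theory numFieldNormedType.Exports.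
Local Open Scope ring_scope.

(** Everything fits into one cycle of implications. Passing from eta to u_I eta
    is monotone in eta and antitone in I, and ru implies n, which implies ucc.
    Hence, with I the ideal of compactly supported functions, all the
    unbounded modifications in question, u(ucc) included, lie between the
    strongest, u(ru), and the weakest, u_I(ucc). The cycle is closed by
    going from the weakest back to ucc and from ucc back to the strongest.

    - ucc implies u(ru) [ucc_uru]: for u >= 0 in C_0, the function sqrt u is
      again in C_0 and regulates the convergence of |x_a - x| /\ u to 0. Where
      sqrt u < eps, one has u = sqrt u * sqrt u <= eps * sqrt u; the remaining
      set, where sqrt u >= eps, is compact, so that eventually
      |x_a - x| <= eps^2 <= eps * sqrt u on it.

    - u_I(ucc) implies ucc [uI_Cc_ucc]: by local compactness and complete
      regularity, each point has a bump u >= 0 in C_c with u > 1/2 around it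
      [Cc_bump]. Near that point, |x_a - x| /\ u < min(eps, 1/2) forces
      |x_a - x| < eps. A compact set is covered by finitely many such
      neighbourhoods, so these local estimates hold simultaneously from some
      index on. *)

(** * Monotonicity of unbounded modifications *)

Section Modifications.
Context {R : realType} {X : vectorLatticeType R}.
Implicit Types (eta zeta : convergence X) (I J : vlideal X).

Definition stronger eta zeta :=
  forall (A : directedType) (x_ : A -> X) (x : X), eta A x_ x -> zeta A x_ x.

Lemma stronger_trans {zeta eta xi} :
  stronger eta zeta -> stronger zeta xi -> stronger eta xi.
Proof. by move=> ez zx A x_ x /ez /zx. Qed.

Lemma stronger_coincide {eta zeta} :
  stronger eta zeta -> stronger zeta eta -> coincide eta zeta.
Proof. by move=> ez ze A x_ x; split; [exact: ez|exact: ze]. Qed.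

Lemma stronger_uI {I eta zeta} :
  stronger eta zeta -> stronger (uI I eta) (uI I zeta).
Proof. by move=> ez A x_ x h u Iu u0; exact/ez/h. Qed.

Lemma stronger_uconv_uI {I eta} : stronger (uconv eta) (uI I eta).
Proof. by move=> A x_ x h u _ u0; exact: h. Qed.

End Modifications.

Section C0Convergences.
Context {R : realType} {T : topologicalType}.
Local Notation C0 := (C0 R T).
Local Notation X := (C0_VL R T).
Local Notation n := (nconv C0 : convergence X).
Local Notation ucc := (ucc R T : convergence X).
Implicit Types (A : directedType) (x u : C0).

(** * Pointwise descriptions *)

Lemma vabs_C0E (u : X) t : (vabs u : C0) t = `|(u : C0) t|.
Proof. by rewrite -maxrN. Qed.

Lemma uccP A (x_ : A -> C0) x :
  ucc A x_ x <-> forall K, compact K -> forall eps : R, 0 < eps ->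
    \forall a \near tails A, forall t, K t -> `|x_ a t - x t| < eps.
Proof.
split=> [h K cK e e0|h K cK P].
  apply: (h K cK [set f | forall t, K t -> `|f t - x t| < e]).
  apply/uniform_nbhs; exists [set xy | ball xy.1 e xy.2].
  split; first by rewrite -entourage_ballE; exists e.
  by move=> f /= H y /H; rewrite /ball /= distrC.
move=> /uniform_nbhs[E [+ EP]].
rewrite -entourage_ballE => -[e e0 eE].
apply: filterS (h K cK e e0) => a H; apply: EP => t Kt; apply: eE => /=.
by rewrite /ball /= distrC; exact: H.
Qed.

Lemma nconvP A (x_ : A -> C0) x :
  n A x_ x <-> forall eps : R, 0 < eps ->
    \forall a \near tails A, forall t, `|x_ a t - x t| <= eps.
Proof.
split=> [/cvgrPdist_le h e e0|h].
  apply: filterS (h e e0) => a H t; rewrite distrC.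
  by apply: le_trans H; exact: (C0_norm_ge (x - x_ a) t).
apply/cvgrPdist_le => e e0; apply: filterS (h e e0) => a H.
apply: (@C0_norm_le _ _ (x - x_ a)) => [|t]; first exact: ltW.
by rewrite -[leLHS]/(`|x t - x_ a t|) distrC.
Qed.

Lemma ru_n : stronger (ru X) n.
Proof.
move=> A x_ x [e e0 h]; apply/nconvP => eps eps0.
(* The +1 keeps the divisor positive even if e = 0. *)
have k0 : 0 < C0_norm e + 1 by rewrite ltr_wpDl// C0_norm_ge0.
apply: filterS (h (eps / (C0_norm e + 1)) _); last exact: divr_gt0.
move=> a /= H t; rewrite -[leLHS](vabs_C0E (x_ a - x : X) t).
apply: le_trans (H t) _.
rewrite -[leLHS]/(eps / (C0_norm e + 1) * (e : C0) t) mulrAC ler_pdivrMr//.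
rewrite ler_pM2l//; apply: (le_trans (ler_norm _)).
by apply: (le_trans (C0_norm_ge e t)); rewrite lerDl.
Qed.

Lemma n_ucc : stronger n ucc.
Proof.
move=> A x_ x /nconvP h; apply/uccP => K _ eps eps0.
have e2 : 0 < eps / 2 by rewrite divr_gt0.
apply: filterS (h _ e2) => a H t _; apply: le_lt_trans (H t) _.
by rewrite ltr_pdivrMr// ltr_pMr// ltr1n.
Qed.

(** * Square roots regulate unbounded convergence *)

(** The square root vanishes at infinity because sqrt u >= e forces
    u >= e^2. For negative values of u, Num.sqrt is 0. *)
Lemma C0_sqrt_mem u : (fun t => Num.sqrt (u t)) \in @C0_pred R T.
Proof.
have cs : continuous (fun t => Num.sqrt (u t)).
  move=> t; apply: continuous_comp; first exact: C0_continuous.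
  exact: sqrt_continuous.
apply/C0_predP; split=> // e e0.
apply: subclosed_compact (@C0_vanish _ _ u (e ^+ 2) (exprn_gt0 2 e0)) _.
  exact: closed_ge_norm.
move=> t /=; rewrite ger0_norm ?sqrtr_ge0// => es.
have ut0 : 0 <= u t.
  by rewrite leNgt; apply/negP => /ltW /ler0_sqrtr us; rewrite us leNgt e0 in es.
rewrite ger0_norm// -(sqr_sqrtr ut0).
by rewrite ler_sqr ?nnegrE ?sqrtr_ge0// ltW.
Qed.

Definition C0_sqrt u : C0 := MkC0 (C0_sqrt_mem u).

(** The choice of sqrt u as regulator is what makes relative uniform convergence
    reachable: u itself would not do, as u <= eps * u fails for eps < 1 at
    points where u > 0, however small u is there. *)
Lemma ucc_uru : stronger ucc (uconv (ru X)).
Proof.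
move=> A x_ x /uccP h u _ u0.
exists (C0_sqrt u : X) => [t|eps eps0]; first exact: sqrtr_ge0.
have e2 : 0 < eps ^+ 2 by exact: exprn_gt0.
apply: filterS (h _ (@C0_vanish _ _ (C0_sqrt u) _ eps0) _ e2) => a H t.
rewrite vabs_C0E.
set m := vmeet _ _; rewrite -[leLHS]/(`|(m : C0) t - 0|) subr0.
have -> : (m : C0) t = Num.min `|x_ a t - x t| ((u : C0) t).
  by rewrite -[`|_ - _|](vabs_C0E (x_ a - x : X) t).
have ut0 : 0 <= (u : C0) t := u0 t.
rewrite ger0_norm ?le_min ?normr_ge0//.
rewrite -[leRHS]/(eps * Num.sqrt ((u : C0) t)).
have [es|es] := leP eps (Num.sqrt ((u : C0) t)).
  rewrite ge_min; apply/orP; left; apply: (@le_trans _ _ (eps ^+ 2)).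
    by apply/ltW/H; rewrite /= ger0_norm ?sqrtr_ge0.
  by rewrite expr2 ler_pM2l.
rewrite ge_min; apply/orP; right; rewrite -[leLHS](sqr_sqrtr ut0) expr2.
by apply: ler_wpM2r; rewrite ?sqrtr_ge0// ltW.
Qed.

(** * Bump functions detect convergence on compact sets *)

Context (hT : hausdorff_space T) (lcT : locally_compact [set: T]).

Lemma Cc_bump (t0 : T) : exists2 u : C0, Cc_set u & vpos (u : X) /\ u t0 = 1.
Proof.
have [K + [cK clK]] := lcT t0 I.
rewrite withinET => Kt0.
(* f separates t0 from the complement of the interior of K; the bump is
   1 - f, whose support lies in K. *)
have clB : closed (~` K°) by apply: open_closedC; exact: open_interior.
have Bt0 : ~ (~` K°) t0 by apply.
have /(uniform_separatorP (R := R))[f [cf f01 f0 f1]] :=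
  @locally_compact_completely_regular T R lcT hT t0 _ clB Bt0.
have ft0 : f t0 = 0 by apply: f0; exists t0.
have fK t : 1 - f t != 0 -> K t.
  move=> ft; apply: interior_subset; apply: contrapT => Kt; move/eqP: ft; apply.
  by rewrite (f1 (f t)) ?subrr//; exists t.
have cg : continuous (fun t => 1 - f t).
  by move=> t; apply: (@continuousB _ R^o _ (fun=> 1) f); [exact: cvg_cst|exact: cf].
have gC0 : (fun t => 1 - f t) \in @C0_pred R T.
  apply/C0_predP; split=> // e e0; apply: subclosed_compact cK _.
    exact: closed_ge_norm.
  move=> t /= et; apply: fK; rewrite -normr_gt0; exact: lt_le_trans et.
exists (MkC0 gC0).
  apply: subclosed_compact cK _; first exact: closed_closure.
  by move/closure_id: clK => ->; apply: closureS => t; exact: fK.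
split=> [t|] /=; last by rewrite ft0 subr0.
have /= := f01 (f t) (ex_intro2 _ _ t I erefl).
by rewrite in_itv/= => /andP[_ ft1]; rewrite -[leRHS]/(1 - f t) subr_ge0.
Qed.

(** The cut-off 1/2 in the estimate guarantees that, near the centre of the
    bump, the minimum of |x_a - x| and the bump is not attained by the bump. *)
Lemma uI_Cc_ucc : stronger (uI (Cc R T) ucc) ucc.
Proof.
move=> A x_ x h; apply/uccP => K cK eps eps0.
move/compact_near_coveringP/near_covering_withinP: (cK).
apply=> t0 Kt0; have [u cu [u0 ut0]] := Cc_bump t0.
have e0 : 0 < Num.min eps 2^-1 by rewrite lt_min eps0 invr_gt0 ltr0n.
have near_u : \forall t \near t0, 2^-1 < u t.
  apply: cvgr_gt (@C0_continuous _ _ u t0) _ _.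
  by rewrite ut0 invf_lt1 ?ltr1n.
have near_x : \forall a \near tails A, forall t, K t ->
    Num.min `|x_ a t - x t| (u t) < Num.min eps 2^-1.
  have /uccP/(_ K cK _ e0) := h u cu u0; apply: filterS => a H t Kt.
  apply: le_lt_trans (H t Kt); rewrite -[leRHS]/(`|Num.min _ _ - 0|) subr0.
  by rewrite -[`|x_ a t - x t|](vabs_C0E (x_ a - x : X) t) ler_norm.
near=> t a => Kt.
have /(_ t Kt) : forall t, K t ->
    Num.min `|x_ a t - x t| (u t) < Num.min eps 2^-1 by near: a.
have ut : 2^-1 < u t by near: t.
case: (leP `|x_ a t - x t|) => _; first by rewrite lt_min => /andP[].
by rewrite lt_min => /andP[_ /(lt_trans ut)]; rewrite ltxx.
Unshelve. all: by end_near. Qed.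
End C0Convergences.

(** * Coincidence of the five convergences *)

Theorem proposition5p7 (R : realType) (T : topologicalType)
    (hT : hausdorff_space T) (lcT : locally_compact [set: T]) :
  let X := C0_VL R T in
  let I := Cc R T in
  let n : convergence X := nconv (C0 R T) in
  let ucc : convergence X := ucc R T in
  [/\ coincide (uconv (ru X)) (uI I (ru X)),
      coincide (uI I (ru X)) (uconv n),
      coincide (uconv n) (uI I n),
      coincide (uI I n) ucc &
      unbounded ucc].
Proof.
move=> X I n ucc.
(* The cycle gives that u eta and u_I eta are both equivalent to ucc as soon as
   eta lies between ru and ucc; eta is then taken to be ru, n and ucc. *)
have ucc_uI (eta : convergence X) : stronger (ru X) eta -> stronger ucc (uI I eta).
  move=> re; apply: (stronger_trans ucc_uru).
  exact: stronger_trans (stronger_uI re) stronger_uconv_uI.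
have ucc_u (eta : convergence X) : stronger (ru X) eta -> stronger ucc (uconv eta).
  by move=> re; apply: (stronger_trans ucc_uru); exact: stronger_uI.
have uI_to_ucc (eta : convergence X) : stronger eta ucc -> stronger (uI I eta) ucc.
  move=> eu; apply: stronger_trans (stronger_uI eu) _; exact: uI_Cc_ucc.
have u_to_ucc (eta : convergence X) : stronger eta ucc -> stronger (uconv eta) ucc.
  by move=> eu; apply: stronger_trans stronger_uconv_uI (uI_to_ucc _ eu).
have ruu : stronger (ru X) ucc := stronger_trans ru_n n_ucc.
have ruru : stronger (ru X) (ru X) by [].
have uu : stronger ucc ucc by [].
split; apply: stronger_coincide; try exact: stronger_uconv_uI.
- exact: stronger_trans (uI_to_ucc _ ruu) (ucc_u _ ruru).
- exact: stronger_trans (uI_to_ucc _ ruu) (ucc_u _ ru_n).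
- exact: stronger_trans (u_to_ucc _ n_ucc) (ucc_uI _ ruru).
- exact: stronger_trans (uI_to_ucc _ n_ucc) (ucc_u _ ru_n).
- exact: uI_to_ucc n_ucc.
- exact: ucc_uI ru_n.
- exact: u_to_ucc uu.
- exact: ucc_u ruu.
Qed.
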